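(* Let $\mu$ be a super-strict partition with $|\mu|\ge 2$, and let $\tau=(\mu_1-1,\mu_2,\mu_3,\ldots)$, so that $\mu=\tau+(1)$. Then $$\Theta_\mu\!\left(\frac{zt}{1-zt}\right)=F_{\tau}(z,1)+F_{\tau,\mu}(z,t).$$ In particular $F_\mu(z,1)=\left.\Theta_\mu\!\left(\frac{zt}{1-zt}\right)\right|_{t=1}$, i.e. $\sum_{n\ge1}|\mathrm{Av}_n(\mu)|z^n$ equals this specialization.
   Context: A partition is a weakly decreasing sequence $\alpha_1\ge\alpha_2\ge\cdots$ of nonnegative integers with finitely many nonzero terms (its parts); its weight is $|\alpha|=\sum_i\alpha_i$. A partition is identified with its Ferrers board (row $i$ has $\alpha_i$ boxes, rows top- and left-justified). A partition $\alpha$ contains $\mu$ if one can delete some set of rows and some set of columns from the Ferrers board of $\alpha$ so that, after top/left-justifying the remaining boxes, one obtains the Ferrers board of $\mu$; otherwise $\alpha$ avoids $\mu$. $\mathrm{Av}_n(\mu)$ is the set of partitions of weight $n$ avoiding $\mu$. A partition is strict if its positive parts are distinct, and super-strict if any two of its positive parts differ by at least $2$. For partitions $\alpha,\beta$, $\alpha+\beta=(\alpha_1+\beta_1,\alpha_2+\beta_2,\ldots)$; $(w^m)$ denotes the partition with $m$ parts equal to $w$. $m(\alpha)$ is the multiplicity of the largest part $\alpha_1$ in $\alpha$. For partitions $\tau,\mu$, $\mathcal Q(\tau,\mu)$ is the set of partitions of positive weight that contain $\tau$ and avoid $\mu$. For a set $S$ of partitions, $F_S(z,t)=\sum_{\alpha\in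 S}z^{|\alpha|}t^{m(\alpha)}$ ($F_\emptyset=0$); $F_\mu(z,t)$ denotes $F_S$ for $S$ the set of partitions of positive weight avoiding $\mu$, and $F_{\tau,\mu}(z,t)=F_{\mathcal Q(\tau,\mu)}(z,t)$. Operators on series $G(z,t)=\sum_{n\ge1}\sum_{m\ge0}a_{n,m}z^nt^m$: $\mathcal E G(z,t)=\dfrac{G(z,1)-ztG(z,zt)}{1-zt}$, and $\mathcal N G(z,t)=G(z,0)+\sum_{n\ge1}\sum_{m\ge1}a_{n,m}\dfrac{1}{1-z^m}\cdot\dfrac{1-(tz)^m}{1-tz}z^n$. The southeast border of a partition $\mu$ is the lattice path of unit east and north steps from the bottom-left to the top-right corner of its Ferrers board tracing the bottoms of the columns and right ends of the rows. For strict $\mu$ every north step other than the last is immediately followed by an east step; such a pair is called a north-east step, so the border is read as: an initial east step, then a sequence of east and north-east steps, then a final north step. For super-strict $\mu$ of weight $\ge2$, $\Theta_\mu$ is the sequence of symbols obtained by reading this border from bottom-left to top-right, ignoring the initial east step and the final east step followed by the final north step, and recording each east step as $\mathcal E$ and each north-east step as $\mathcal N$ (e.g. $\Theta_{(8,5,3)}=(\mathcal E,\mathcal E,\mathcal N,\mathcal E,\mathcal N,\mathcal E)$, $\Theta_{(2)}=\emptyset$). For $\Theta=(\Theta_1,\ldots,\Theta_r)$, $\Theta G=\Theta_r\circ\cdots\circ\Theta_1 G$, and $\emptyset G=G$. *)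

(* Defs.v *)
From HB Require Import structures.
From mathcomp Require Import all_boot all_order all_algebra.
Set Implicit Arguments. Unset Strict Implicit. Unset Printing Implicit Defensive.
Import Order.TTheory GRing.Theory Num.Theory.

Definition is_partition (s : seq nat) : bool :=
  sorted geq s && all (fun x => 0 < x) s.

Definition superstrict (s : seq nat) : bool :=
  sorted (fun x y => y.+2 <= x) s && all (fun x => 0 < x) s.

Definition weight (s : seq nat) : nat := sumn s.

Definition mult (s : seq nat) : nat := count_mem (head 0 s) s.

(* Containment: delete a set of rows (mask rm, kept = true) and a set of
   columns (mask cm, kept = true) of the Ferrers board of a; after
   justification, a kept row of length r has (number of kept columns among
   the first r) boxes.  Empty rows are discarded. *)
Definition contains (a mu : seq nat) : bool :=
  [exists rm : (size a).-tuple bool, exists cm : (head 0 a).-tuple bool,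
     [seq x <- [seq count id (take r cm) | r <- mask rm a] | 0 < x] == mu].

Definition avoids (a mu : seq nat) : bool := ~~ contains a mu.

(* partitions of n <-> weakly decreasing n-tuples with entries <= n summing
   to n (padded with zeros) *)
Definition part_of n (t : n.-tuple 'I_n.+1) : seq nat :=
  [seq x <- [seq val i | i <- t] | 0 < x].

Definition is_part_tuple n (t : n.-tuple 'I_n.+1) : bool :=
  sorted geq [seq val i | i <- t] && (sumn [seq val i | i <- t] == n).

Local Open Scope ring_scope.

(* G n is the coefficient of z^n, a polynomial in t. *)
Definition series := nat -> {poly int}.

Definition Fser (P : seq nat -> bool) : series := fun n =>
  if n == 0%N then 0 else
  \sum_(t : n.-tuple 'I_n.+1 | is_part_tuple t && P (part_of t))
     'X^(mult (part_of t)).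

Definition at1 (G : series) : series := fun n => ((G n).[1])%:P.

Definition zt_series : series := fun n => if n == 0%N then 0 else 'X^n.

(* G(z,zt): coefficient of z^p is sum_{i+m=p} a_{i,m} t^m *)
Definition subst_zt (G : series) : series := fun p =>
  \sum_(i < p.+1) (G i)`_(p - i) *: 'X^(p - i).

(* E G = (G(z,1) - zt G(z,zt)) * sum_k (zt)^k *)
Definition opE (G : series) : series := fun n =>
  let A := fun p => ((G p).[1])%:P -
                    (if p == 0%N then 0 else 'X * subst_zt G p.-1) in
  \sum_(k < n.+1) A (n - k)%N * 'X^k.

(* N G = G(z,0) + sum_{n>=1,m>=1} a_{n,m} 1/(1-z^m) (1-(tz)^m)/(1-tz) z^n *)
Definition opN (G : series) : series := fun N =>
  ((G N).[0])%:P +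
  \sum_(n < N.+1 | (0 < n)%N) \sum_(m < size (G n) | (0 < m)%N)
    \sum_(k < N.+1) \sum_(j < m | (n + m * k + j == N)%N)
       (G n)`_m *: 'X^j.

Inductive sym := SymE | SymN.

(* southeast border, bottom-left to top-right; true = east, false = north *)
Definition border (mu : seq nat) : seq bool :=
  flatten [seq rcons (nseq d true) false
          | d <- pairmap (fun x y => (y - x)%N) 0%N (rev mu)].

Fixpoint tok (s : seq bool) : seq sym :=
  match s with
  | true :: s' => SymE :: tok s'
  | false :: true :: s' => SymN :: tok s'
  | _ => [::]
  end.

(* ignore the initial east step and the final east + north steps *)
Definition Theta_seq (mu : seq nat) : seq sym :=
  let b := border mu in tok (take (size b - 3) (behead b)).

Definition apply_sym (o : sym) (G : series) : series :=
  match o with SymE => opE G | SymN => opN G end.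

Definition Theta (mu : seq nat) (G : series) : series :=
  foldl (fun H o => apply_sym o H) G (Theta_seq mu).

(* Main.v *)
Require Import Defs.
From HB Require Import structures.
From mathcomp Require Import all_boot all_order all_algebra.
From mathcomp Require Import zify.
Set Implicit Arguments. Unset Strict Implicit. Unset Printing Implicit Defensive.
Import Order.TTheory GRing.Theory Num.Theory.

(** A partition a contains a strict pattern p iff it has parts b_1 > b_2 > ...,
    as many as p, such that b - p is weakly decreasing and nonnegative.  If
    p = (x, q) and a has largest part M, one may take b_1 = M, and only the
    parts of a below M matter for the rest.

    For strict t let t+ = t + (1).  The identity G = F_t(z,1) + F_{t,t+}(z,t)
    propagates along the border of mu, starting from t = (1), G = zt/(1-zt):
    - E replaces t by t+.  Adding a column of height j, 1 <= j <= m(a), to the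
      members a of Q(t,t+) gives each member of Q(t+,t++) once, and it has
      largest part of multiplicity j.
    - N replaces t by u = (t_1 + 1, t).  Raising the m = m(a) largest parts of
      the members a of Q(t,t+) by k >= 0 gives each member of Q(t,u) once;
      adding then a column of height j, 1 <= j < m, gives each member of
      Q(u,u+) once.
    At z^n the indices j and k are determined by n: E sends z^w t^m to the sum
    of z^n t^(n-w) over w <= n <= w + m, and N sends it to the sum of
    z^n t^((n-w) mod m) over n >= w if m > 0, and fixes z^w. *)

(** * Containment of strict patterns *)

Definition strict (s : seq nat) : bool :=
  sorted gtn s && all (fun x => 0 < x) s.

(* The part of [a] matched with the head of [p] is at most [v]. *)
Fixpoint reach (a p : seq nat) (v : nat) : bool :=
  if p is x :: p' then
    has (fun y => [&& y <= v, x - head 0 p' <= y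
                    & reach a p' (y - (x - head 0 p'))]) a
  else true.

Lemma reach_leq a p v w : v <= w -> reach a p v -> reach a p w.
Proof.
case: p => //= x p le_vw; apply: sub_has => y /= /and3P[yv -> ->].
by rewrite (leq_trans yv).
Qed.

(** The bound only decreases along the recursion, so every matched part is at most [v]. As the
    matched parts are distinct values, multiplicities do not matter either. *)
Lemma reach_sub a b p v :
  {in a, forall y, y <= v -> y \in b} -> reach a p v -> reach b p v.
Proof.
elim: p v => //= x p IH v sub_ab /hasP[y ay /and3P[yv xy ry]].
apply/hasP; exists y; first exact: sub_ab.
rewrite yv xy /=; apply: IH ry => z az zy; apply: sub_ab => //.
by rewrite (leq_trans zy) // (leq_trans (leq_subr _ _)).
Qed.

Lemma eq_reach a b p v :
  (forall y, y <= v -> (y \in a) = (y \in b)) -> reach a p v = reach b p v.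
Proof.
by move=> eq_ab; apply/idP/idP; apply: reach_sub => y + yv; rewrite eq_ab.
Qed.

Lemma head_le_sorted a y : sorted geq a -> y \in a -> y <= head 0 a.
Proof.
case: a => //= x a; rewrite path_sortedE; last by move=> ? ? ? /= h1 h2; lia.
by case/andP=> /allP ax _; rewrite inE => /predU1P[->//|/ax].
Qed.

(** Here [c i] stands for the number of kept columns among the first [i]. Since [c] grows by at most
    1 per column, each gap of [map c b] is at most the gap of [b], so the entries of [b] themselves
    serve as matched parts. *)
Lemma reach_map_lipschitz (a b : seq nat) (c : nat -> nat) v :
  c 0 = 0 -> (forall i j, i <= j -> c i <= c j /\ c j - c i <= j - i) ->
  {subset b <= a} -> sorted geq b -> head 0 b <= v ->
  reach a (map c b) v.
Proof.
move=> c0 cL; elim: b v => //= y b IH v sub_ba sb yv.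
have hc : head 0 (map c b) = c (head 0 b) by case: (b).
have yb : head 0 b <= y by case: (b) sb => //= z b' /andP[].
have [_ cy] := cL _ _ yb; have [_ cy0] := cL 0 y (leq0n _).
apply/hasP; exists y; first by rewrite sub_ba ?mem_head.
rewrite yv hc /=; apply/andP; split; first by lia.
apply: IH; last by lia.
  by move=> z zb; rewrite sub_ba // inE zb orbT.
exact: path_sorted sb.
Qed.

Lemma count_take_lipschitz (cm : seq bool) i j : i <= j ->
  count id (take i cm) <= count id (take j cm) /\
  count id (take j cm) - count id (take i cm) <= j - i.
Proof.
elim: cm i j => [|b cm IH] [|i] [|j] //= ij; last by have /IH[] : i <= j by []; lia.
by split=> //; have [] := IH 0 j (leq0n _); rewrite take0 /= => _; lia.
Qed.

(** The column mask is built from the shortest matched row upwards: between consecutive matched rows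
    there are at least as many columns as the gap of the pattern. *)
Lemma reach_chain (a p : seq nat) v : strict p -> reach a p v ->
  exists b, [/\ {subset b <= a}, sorted gtn b, head 0 b <= v &
    exists2 cm, size cm = head 0 b & [seq count id (take r cm) | r <- b] = p].
Proof.
elim: p v => [|x p IH] v /=; first by move=> _ _; exists [::]; split=> //; exists [::].
move=> /andP[sx /andP[x0 px0]] /hasP[y ay /and3P[yv xy /IH[]]].
  by rewrite /strict (path_sorted sx).
move=> b [ba sb by_ [cm scm ecm]].
have dpos : head 0 p < x by case: (p) sx => //= z p' /andP[].
have yb : head 0 b < y by lia.
exists (y :: b); split=> //.
- by move=> z; rewrite inE => /predU1P[->//|/ba].
- by case: (b) sb yb => //= z b' -> ->.
(* Beyond column [head 0 b], the first [x - head 0 p] columns are kept and the others up to [y] are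
   deleted. *)
exists (cm ++ nseq (x - head 0 p) true ++ nseq (y - head 0 b - (x - head 0 p)) false).
  by rewrite !size_cat !size_nseq scm /=; lia.
rewrite /= take_oversize; last by rewrite !size_cat !size_nseq scm; lia.
congr (_ :: _).
  rewrite !count_cat !count_nseq /= mul1n mul0n addn0.
  have -> : count id cm = head 0 p.
    case: (b) scm ecm => [|z b'] /= scm <-; first by case: (cm) scm.
    by rewrite /= take_oversize ?scm.
  by lia.
rewrite -[RHS]ecm; apply/eq_in_map => z zb; rewrite takel_cat // scm.
have sb' : sorted geq b by apply: sub_sorted sb => i j /=; lia.
exact: head_le_sorted.
Qed.

(** Without repetitions [a] is strictly decreasing, and [b] is a filter of it. This supplies the row
    mask in [containsE]. *)
Lemma subseq_strict (a b : seq nat) :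
  sorted geq a -> sorted gtn b -> {subset b <= a} -> subseq b a.
Proof.
move=> sa sb ba.
have gtr : transitive gtn by move=> ? ? ? /= h1 h2; lia.
have ger : transitive geq by move=> ? ? ? /= h1 h2; lia.
have su : sorted gtn (undup a).
  have := subseq_sorted ger (undup_subseq a) sa.
  elim: (undup a) (undup_uniq a) => //= x s IH /andP[xs us].
  rewrite !path_sortedE // => /andP[/allP xa ss]; rewrite IH // andbT.
  apply/allP => y ys; have := xa y ys => /=.
  have : x != y by apply: contraNneq xs => ->.
  lia.
have -> : b = [seq x <- undup a | x \in b].
  apply: (irr_sorted_eq gtr) => //; first by move=> x /=; rewrite ltnn.
    exact: sorted_filter.
  by move=> x; rewrite mem_filter mem_undup; case xb: (x \in b); rewrite ?(ba _ xb).
exact: subseq_trans (filter_subseq _ _) (undup_subseq a).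
Qed.

(** From left to right, the kept rows that retain a box serve as matched parts. From right to left,
    the mask of [reach_chain] is padded with deleted columns to the width of [a]. *)
Lemma containsE (a p : seq nat) v : sorted geq a -> head 0 a <= v -> strict p ->
  contains a p = reach a p v.
Proof.
move=> sa av sp; apply/existsP/idP => [[rm /existsP[cm /eqP <-]]|].
  (* Discarding empty rows becomes a filter on the kept rows, so the pattern has the form
     [map c b]. *)
  rewrite filter_map; apply: reach_map_lipschitz; rewrite ?take0 //.
  - exact: count_take_lipschitz.
  - by move=> y; rewrite mem_filter => /andP[_ /mem_mask].
  - apply: sorted_filter; first by move=> ? ? ? /= h1 h2; lia.
    by apply: sorted_mask sa => ? ? ? /= h1 h2; lia.
  set b := filter _ _.
  have ba : {subset b <= a} by move=> y; rewrite mem_filter => /andP[_ /mem_mask].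
  case: b ba => //= y b ba; apply: leq_trans av; apply: head_le_sorted => //.
  by rewrite ba ?mem_head.
case/(reach_chain sp) => b [ba sb bv [cm scm ecm]].
have /subseqP[rm srm eb] := subseq_strict sa sb ba.
have ha : head 0 b <= head 0 a.
  case: (b) ba => //= z b' ba; apply: head_le_sorted => //.
  by rewrite ba ?mem_head.
have sc : size (cm ++ nseq (head 0 a - head 0 b) false) == head 0 a.
  by rewrite size_cat size_nseq scm subnKC.
have sr : size rm == size a by rewrite srm.
exists (Tuple sr); apply/existsP; exists (Tuple sc) => /=.
rewrite -eb; set q := [seq count _ _ | _ <- _].
have -> : q = p.
  rewrite /q -[RHS]ecm; apply/eq_in_map => z zb; rewrite takel_cat // scm.
  by apply: head_le_sorted zb; apply: sub_sorted sb => i j /=; lia.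
by apply/eqP/all_filterP; case/andP: sp.
Qed.

Lemma strict_cons x p : strict (x :: p) = (head 0 p < x) && strict p.
Proof. by case: p => [|y p]; rewrite /strict /=; lia. Qed.

Lemma strict_succ x p : strict (x :: p) -> strict (x.+1 :: p).
Proof. by rewrite !strict_cons => /andP[h ->]; rewrite ltnS ltnW. Qed.

(** * Matching from the largest part *)

Section Top.
Variables (M m : nat) (r : seq nat).
Hypotheses (m_gt0 : 0 < m) (r_lt : all (gtn M) r) (r_part : is_partition r).
Let a := nseq m M ++ r.

Lemma head_top : head 0 a = M.
Proof. by rewrite /a; case: m m_gt0. Qed.

Lemma mult_top : mult a = m.
Proof.
rewrite /mult head_top /a count_cat count_nseq /= eqxx mul1n.
rewrite (_ : count _ r = 0) ?addn0 //; apply/eqP; rewrite -leqn0 leqNgt -has_count.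
by apply/hasPn => y /(allP r_lt) /= yM; rewrite neq_ltn yM.
Qed.

Lemma part_top : 0 < M -> is_partition a.
Proof.
case/andP: r_part => sr pr M0; rewrite /is_partition /a all_cat pr andbT.
rewrite all_nseq M0 orbT andbT.
elim: m => //= k IH; case: k IH => /= [|k]; last by move=> ->; rewrite leqnn.
rewrite path_sortedE; last by move=> ? ? ? /= h1 h2; lia.
by rewrite sr andbT => _; apply: sub_all r_lt => y /=; lia.
Qed.

(** Matching the head of the pattern with [M] leaves the weakest bound for the other parts. The gap
    being positive, that bound is below [M], so only [r] matters. *)
Lemma contains_top x p : strict (x :: p) ->
  contains a (x :: p) =
    (x - head 0 p <= M) && reach r p (M - (x - head 0 p)).
Proof.
move=> sp; have [] := andP sp; rewrite /= => _ /andP[x0 _].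
have xp : head 0 p < x by move: sp; rewrite strict_cons => /andP[].
have [M0|M0] := posnP M.
  (* All parts are zero here, while the gap [x - head 0 p] is positive. *)
  rewrite M0 leqn0 subn_eq0 leqNgt xp /=; move: r_lt; rewrite /a M0.
  case: (r) => //= _; rewrite cats0.
  rewrite (@containsE _ _ 0) //; first last.
  - by case: (m).
  - by elim: (m) => //= k; case: k => //= k ->.
  by apply/hasP => -[y]; rewrite mem_nseq => /andP[_ /eqP->] /=; lia.
have /andP[sa _] := part_top M0.
rewrite (@containsE _ _ M) ?head_top //.
have eqr v : v < M -> reach a p v = reach r p v.
  move=> vM; apply: eq_reach => y yv; rewrite mem_cat mem_nseq.
  by rewrite (_ : (y == M) = false) ?andbF //; lia.
apply/hasP/andP => [[y ya /and3P[yM xy ry]]|[xM rr]].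
  split; first by lia.
  by rewrite -eqr; [apply: reach_leq ry; lia | lia].
exists M => /=; first by rewrite mem_cat mem_nseq m_gt0 eqxx.
rewrite leqnn xM -/(reach a p _) eqr //; lia.
Qed.

End Top.

Lemma topP a : is_partition a -> 0 < weight a ->
  exists M r, [/\ a = nseq (mult a) M ++ r, 0 < mult a, 0 < M,
                  all (gtn M) r & is_partition r].
Proof.
case/andP=> sa pa wa; exists (head 0 a), [seq x <- a | x != head 0 a].
have ger : transitive geq by move=> ? ? ? /= h1 h2; lia.
have m0 : 0 < mult a by case: a wa {sa pa} => //= x a _; rewrite /mult /= eqxx.
have h0 : 0 < head 0 a by case: a pa wa {sa m0} => //= x a /andP[].
have rl : all (gtn (head 0 a)) [seq x <- a | x != head 0 a].
  apply/allP => y; rewrite mem_filter => /andP[yh ya] /=.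
  by have := head_le_sorted sa ya; lia.
have rp : is_partition [seq x <- a | x != head 0 a].
  rewrite /is_partition sorted_filter //=; apply/allP => y.
  by rewrite mem_filter => /andP[_ /(allP pa)].
split=> //.
apply: (sorted_eq ger) => //; first by move=> ? ? /=; lia.
  by have /andP[] := part_top m0 rl rp h0.
have -> : nseq (mult a) (head 0 a) = filter (pred1 (head 0 a)) a.
  by rewrite /mult -size_filter; apply/esym/all_pred1P/filter_all.
by rewrite perm_sym; apply/permPl/perm_filterC.
Qed.

Lemma weight_top M m r : weight (nseq m M ++ r) = M * m + weight r.
Proof. by rewrite /weight sumn_cat sumn_nseq. Qed.

Local Open Scope ring_scope.

(** * The operators on monomials *)

(** Up to degree [N] the series of the argument are finite sums of these, so both operators need
    only be computed here. *)
Definition mono (w m : nat) : series := fun n => if n == w then 'X^m else 0.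

Lemma opE_ext G H N : (forall n, (n <= N)%N -> G n = H n) -> opE G N = opE H N.
Proof.
move=> GH; apply: eq_bigr => k _; congr (_ * _).
rewrite GH ?leq_subr //; congr (_ - _).
case: ifP => // k0; congr (_ * _); apply: eq_bigr => i _.
by rewrite GH //; have := ltn_ord i; lia.
Qed.

Lemma opE_sum I (s : seq I) (G : I -> series) N :
  opE (fun n => \sum_(i <- s) G i n) N = \sum_(i <- s) opE (G i) N.
Proof.
rewrite /opE exchange_big; apply: eq_bigr => k _ /=.
rewrite -mulr_suml; congr (_ * _); rewrite big_split sumrN /=.
rewrite horner_sum rmorph_sum; congr (_ - _).
case: ifP => _; first by rewrite big1.
rewrite -mulr_sumr exchange_big; congr (_ * _); apply: eq_bigr => i _ /=.
by rewrite coef_sum scaler_suml.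
Qed.

(** The image of z^w t^m is z^w (1 - (zt)^(m+1)) / (1 - zt): two geometric series that cancel from
    degree [w + m + 1] on. *)
Lemma opE_mono w m N :
  opE (mono w m) N = if (w <= N <= w + m)%N then 'X^(N - w) else 0.
Proof.
have subst_mono p : subst_zt (mono w m) p = if p == (w + m)%N then 'X^m else 0.
  rewrite /subst_zt /mono; have [wp|wp] := leqP w p; last first.
    rewrite big1 => [|i _]; first by case: eqP => //; lia.
    rewrite (_ : (i == w :> nat) = false) ?coef0 ?scale0r //.
    by have := ltn_ord i; lia.
  have wp' : (w < p.+1)%N by [].
  rewrite (bigD1 (Ordinal wp')) //= eqxx big1 => [|i /eqP iw].
    rewrite coefXn addr0; have -> : (p == w + m)%N = (p - w == m)%N by lia.
    by case: eqP => [->|_]; rewrite ?scale1r ?scale0r.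
  have /negbTE-> : (i : nat) != w by apply/eqP => iw'; apply: iw; apply: val_inj.
  by rewrite coef0 scale0r.
(* This is the coefficient of z^N in z^v t^e / (1 - zt). *)
have delta (v e : nat) : \sum_(k < N.+1)
    (if (N - k == v)%N then 'X^e else 0) * 'X^k =
    if (v <= N)%N then 'X^(e + (N - v)) else 0 :> {poly int}.
  have [vN|vN] := leqP v N; last first.
    by rewrite big1 // => k _; case: eqP; rewrite ?mul0r //; lia.
  have kP : (N - v < N.+1)%N by lia.
  rewrite (bigD1 (Ordinal kP)) //= subKn // eqxx -exprD big1 ?addr0 // => k kv.
  case: eqP => [Nk|]; rewrite ?mul0r //; case/eqP: kv; apply: val_inj => /=.
  by have := ltn_ord k; lia.
rewrite /opE; transitivity (\sum_(k < N.+1)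
   (((if (N - k == w)%N then 'X^0 else 0 : {poly int}) * 'X^k) -
    ((if (N - k == (w + m).+1)%N then 'X^(m.+1) else 0 : {poly int}) * 'X^k))).
  apply: eq_bigr => k _; rewrite -mulrBl; congr (_ * _); congr (_ - _).
    by rewrite /mono; case: eqP; rewrite ?hornerXn ?expr1n ?horner0.
  case: (N - k)%N => //= n; rewrite subst_mono eqSS.
  by case: eqP; rewrite ?mulr0 // exprS.
rewrite sumrB !delta add0n.
have [wN|wN] := leqP w N => /=; last by rewrite (_ : (w + m < N)%N = false) ?subrr //; lia.
have [|wm] := leqP N (w + m); first by rewrite subr0.
by rewrite (_ : (m.+1 + (N - (w + m).+1) = N - w)%N) ?subrr //; lia.
Qed.

(** In [opN] the range of [m] depends on [G]. A common bound [B] gives all summands the same range,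
    which makes additivity visible. *)
Lemma opN_bound B (G : series) N : (forall n, (n <= N)%N -> (size (G n) <= B)%N) ->
  opN G N = ((G N).[0])%:P +
  \sum_(n < N.+1 | (0 < n)%N) \sum_(m < B | (0 < m)%N)
    \sum_(k < N.+1) \sum_(j < m | (n + m * k + j == N)%N)
       (G n)`_m *: 'X^j.
Proof.
move=> sB; rewrite /opN; congr (_ + _); apply: eq_bigr => n _.
have sBn : (size (G n) <= B)%N by rewrite sB // -ltnS.
rewrite (big_ord_widen_cond _ (fun m => (0 < m)%N) (fun m =>
   \sum_(k < N.+1) \sum_(j < m | (n + m * k + j == N)%N) (G n)`_m *: 'X^j) sBn).
rewrite [RHS](bigID (fun m : 'I_B => (m < size (G n))%N)) /=.
rewrite [X in _ = _ + X]big1 ?addr0 // => m /andP[_ mG].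
rewrite big1 // => k _; rewrite big1 // => j _.
by rewrite nth_default ?scale0r // leqNgt.
Qed.

Lemma opN_ext G H N : (forall n, (n <= N)%N -> G n = H n) -> opN G N = opN H N.
Proof.
move=> GH; rewrite /opN GH //; congr (_ + _); apply: eq_bigr => n _.
by rewrite GH // -ltnS.
Qed.

Lemma opN_sum I (s : seq I) (G : I -> series) N :
  opN (fun n => \sum_(i <- s) G i n) N = \sum_(i <- s) opN (G i) N.
Proof.
elim: s => [|i s IH].
  rewrite big_nil -[RHS](_ : opN (fun _ => 0) N = 0).
    by apply: opN_ext => n _; rewrite big_nil.
  rewrite (@opN_bound 0) => [|n _]; last by rewrite size_poly0.
  by rewrite horner0 add0r big1 // => n _; rewrite big_ord0.
rewrite big_cons -{}IH; set H := (fun n => \sum_(i <- s) _).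
rewrite (@opN_ext _ (fun n => G i n + H n)) => [|n _]; last by rewrite /H big_cons.
pose B := \max_(n < N.+1) maxn (size (G i n)) (size (H n)).
have BP n : (n <= N)%N -> (maxn (size (G i n)) (size (H n)) <= B)%N.
  move=> nN; have nN' : (n < N.+1)%N by [].
  exact: (leq_bigmax (F := fun n : 'I_N.+1 => maxn (size (G i n)) (size (H n))) (Ordinal nN')).
rewrite !(@opN_bound B) => [|n /BP|n /BP|n /BP]; rewrite ?geq_max; try by case/andP.
  2: by move=> hB; apply: leq_trans (size_polyD _ _) _; rewrite geq_max.
rewrite hornerD polyCD addrACA; congr (_ + _); rewrite -big_split.
apply: eq_bigr => n _ /=; rewrite -big_split; apply: eq_bigr => m _ /=.
rewrite -big_split; apply: eq_bigr => k _ /=; rewrite -big_split.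
by apply: eq_bigr => j _ /=; rewrite coefD scalerDl.
Qed.

Lemma opN_mono0 w N : opN (mono w 0) N = mono w 0 N.
Proof.
rewrite (@opN_bound 1) => [|n _]; last first.
  by rewrite /mono; case: eqP; rewrite ?expr0 ?size_poly1 ?size_poly0.
rewrite [X in _ + X]big1 ?addr0 => [|n _].
  by rewrite /mono; case: eqP; rewrite ?expr0 ?hornerC ?horner0.
by rewrite big1 // => -[[]].
Qed.

(** Only one pair [k], [j] contributes: the quotient and remainder of [N - w] by [m]. *)
Lemma opN_mono w m N : (0 < w)%N -> (0 < m)%N ->
  opN (mono w m) N = if (w <= N)%N then 'X^((N - w) %% m) else 0.
Proof.
move=> w0 m0; rewrite (@opN_bound m.+1) => [|n _]; last first.
  by rewrite /mono; case: eqP; rewrite ?size_polyXn ?size_poly0.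
have -> : (mono w m N).[0] = 0.
  by rewrite /mono; case: eqP; rewrite ?hornerXn ?horner0 // expr0n; case: (m) m0.
rewrite add0r; have [wN|wN] := leqP w N; last first.
  rewrite big1 // => n _; rewrite /mono (_ : (n == w :> nat) = false); last first.
    by have := ltn_ord n; lia.
  by rewrite big1 // => ? _; rewrite big1 // => ? _; rewrite big1 // => ? _; rewrite coef0 scale0r.
have wN' : (w < N.+1)%N by [].
rewrite (bigD1 (Ordinal wN')) //= [X in _ + X]big1 ?addr0; last first.
  move=> n /andP[_ nw]; rewrite /mono (_ : (n == w :> nat) = false); last first.
    by apply: contraNF nw => /eqP nw; apply/eqP; apply: val_inj.
  by rewrite big1 // => ? _; rewrite big1 // => ? _; rewrite big1 // => ? _; rewrite coef0 scale0r.
rewrite (bigD1 ord_max) //= [X in _ + X]big1 ?addr0; last first.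
  move=> i /andP[_ im]; rewrite big1 // => ? _; rewrite big1 // => ? _.
  rewrite /mono eqxx coefXn (_ : (i == m :> nat) = false) ?scale0r //.
  by apply: contraNF im => /eqP im; apply/eqP; apply: val_inj.
have kP : ((N - w) %/ m < N.+1)%N by have := leq_div (N - w) m; lia.
rewrite (bigD1 (Ordinal kP)) //= [X in _ + X]big1 ?addr0; last first.
  move=> k kw; rewrite big1 // => j /eqP wmk; case/eqP: kw; apply: val_inj => /=.
  have -> : (N - w = k * m + j)%N by lia.
  by rewrite divnMDl // divn_small ?addn0.
rewrite (big_pred1 (Ordinal (ltn_pmod (N - w) m0))) => [|j] /=.
  by rewrite /mono eqxx coefXn eqxx scale1r.
have := divn_eq (N - w) m; rewrite -(inj_eq val_inj) /=; lia.
Qed.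

(** * Enumerating partitions *)

Lemma filter_gt0_sorted (s : seq nat) : sorted geq s ->
  s = [seq x <- s | 0 < x]%N ++ nseq (count_mem 0%N s) 0%N.
Proof.
elim: s => //= x s IH sx; have ss := path_sorted sx.
case: x sx => [|x] sx /=; last by rewrite add0n -IH.
have s0 : s = nseq (size s) 0%N.
  apply/all_pred1P/allP => y ys; move: sx; rewrite path_sortedE.
    by case/andP=> /allP/(_ y ys) /=; lia.
  by move=> ? ? ? /= h1 h2; lia.
by rewrite s0 filter_nseq count_nseq /= mul1n.
Qed.

(** The zeros dropped by [part_of] stand at the end, and the length [n] fixes their number. *)
Lemma part_of_inj n : {in [pred t : n.-tuple 'I_n.+1 | is_part_tuple t] &,
  injective (@part_of n)}.
Proof.
move=> t u /andP[st _] /andP[su _] eq_tu; apply: val_inj.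
apply: (inj_map val_inj) => /=.
rewrite (filter_gt0_sorted st) (filter_gt0_sorted su).
move: eq_tu; rewrite /part_of => eq_tu; rewrite eq_tu; congr (_ ++ nseq _ _).
have := congr1 size (filter_gt0_sorted st); have := congr1 size (filter_gt0_sorted su).
rewrite !size_cat !size_nseq eq_tu !size_map !size_tuple => h1 h2.
by apply: (@addnI (size [seq x <- [seq val i | i <- u] | 0 < x]%N)); rewrite -h1 -h2.
Qed.

Definition partitions_of n :=
  [seq part_of t | t : n.-tuple 'I_n.+1 <- enum [pred t : n.-tuple 'I_n.+1 | is_part_tuple t]].

Lemma partitions_of_uniq n : uniq (partitions_of n).
Proof.
rewrite map_inj_in_uniq ?enum_uniq // => t u; rewrite !mem_enum.
exact: part_of_inj.
Qed.

Lemma sumn_filter_gt0 (s : seq nat) : sumn [seq x <- s | 0 < x]%N = sumn s.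
Proof. by elim: s => //= -[|x] s /= ->. Qed.

Lemma size_le_sumn (s : seq nat) : all (fun x => 0 < x)%N s -> (size s <= sumn s)%N.
Proof. by elim: s => //= x s IH /andP[x0 /IH]; lia. Qed.

Lemma mem_le_sumn (s : seq nat) x : x \in s -> (x <= sumn s)%N.
Proof. by elim: s => //= y s IH; rewrite inE => /predU1P[->|/IH]; lia. Qed.

Lemma mem_partitions_of n a : (a \in partitions_of n) = is_partition a && (weight a == n).
Proof.
have ger : transitive geq by move=> ? ? ? /= h1 h2; lia.
apply/mapP/andP => [[t] |[/andP[sa pa] /eqP wa]].
  rewrite mem_enum => /andP[st wt] ->; split.
    rewrite /is_partition sorted_filter //=; apply/allP => x.
    by rewrite mem_filter => /andP[].
  by rewrite /weight /part_of sumn_filter_gt0.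
(* Padding to length [n] works because positive parts number at most their sum; each part is at most
   [n], so [inord] preserves it. *)
have sz : size (map (@inord n) (a ++ nseq (n - size a) 0%N)) == n.
  rewrite size_map size_cat size_nseq subnKC // -wa; exact: size_le_sumn.
have vt : [seq val i | i <- Tuple sz] = a ++ nseq (n - size a) 0%N.
  rewrite /= -map_comp -[RHS]map_id; apply/eq_in_map => x.
  rewrite mem_cat mem_nseq => /orP[xa|/andP[_ /eqP->]] /=; rewrite inordK //.
  by rewrite ltnS -wa; exact: mem_le_sumn.
exists (Tuple sz); last first.
  rewrite /part_of vt filter_cat filter_nseq /= cats0.
  by apply/esym/all_filterP.
rewrite mem_enum inE /is_part_tuple vt sumn_cat sumn_nseq mul0n addn0 -wa eqxx andbT.
move: (_ - _)%N => k; elim: (a) sa pa => [_ _|x b IH /= sa /andP[x0 pb]]; last first.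
  case: b sa pb IH => [|y b] /=; last by move=> /andP[-> ?] /andP[-> ?] ->.
  by case: (k) => //= k' _ _ ->.
by elim: k => //= -[|k] //= ->.
Qed.

Lemma FserE P n : (0 < n)%N ->
  Fser P n = \sum_(a <- partitions_of n | P a) 'X^(mult a).
Proof.
move=> n0; by rewrite /Fser (gtn_eqF n0) /partitions_of big_map big_enum_cond.
Qed.

(** The form in which bijections enter: [f] maps [s] bijectively onto the partitions that the
    coefficient counts. *)
Lemma Fser_reindex P n (I : eqType) (s : seq I) (f : I -> seq nat) :
  (0 < n)%N -> uniq s -> {in s &, injective f} ->
  (forall a, (a \in map f s) = [&& is_partition a, weight a == n & P a]) ->
  Fser P n = \sum_(i <- s) 'X^(mult (f i)).
Proof.
move=> n0 us fi fs; rewrite FserE // -big_filter -(big_map f xpredT (fun a => 'X^(mult a))).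
apply: perm_big; apply: uniq_perm.
- exact: filter_uniq (partitions_of_uniq n).
- by rewrite map_inj_in_uniq.
by move=> a; rewrite fs mem_filter mem_partitions_of [RHS]andbA [RHS]andbC.
Qed.

Definition partitions_upto N := undup (flatten [seq partitions_of n | n <- iota 1 N]).

Lemma partitions_upto_uniq N : uniq (partitions_upto N).
Proof. exact: undup_uniq. Qed.

Lemma mem_partitions_upto N a : (a \in partitions_upto N) = is_partition a && (0 < weight a <= N)%N.
Proof.
rewrite mem_undup; apply/flatten_mapP/andP => [[n]|[pa wa]].
  by rewrite mem_iota mem_partitions_of => nN /andP[-> /eqP->]; split=> //; lia.
by exists (weight a); rewrite ?mem_iota ?mem_partitions_of ?pa ?eqxx //; lia.
Qed.

(** One list of partitions serves all coefficients up to z^N, as [opE_sum] and [opN_sum] require. *)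
Lemma Fser_mono P N n : (n <= N)%N ->
  Fser P n = \sum_(a <- partitions_upto N | P a) mono (weight a) (mult a) n.
Proof.
move=> nN; have [->|n0] := posnP n.
  rewrite /Fser eqxx big_seq_cond big1 // => a /andP[]; rewrite mem_partitions_upto /mono.
  by case: eqP => //; lia.
rewrite (@Fser_reindex P n _ [seq a <- partitions_upto N | P a && (weight a == n)] id) //.
- rewrite big_filter [RHS](bigID (fun a => weight a == n)) /=.
  rewrite [X in _ = _ + X]big1 ?addr0 => [|a /andP[_ /negbTE wa]].
    by apply: eq_bigr => a /andP[_ /eqP <-]; rewrite /mono eqxx.
  by rewrite /mono eq_sym wa.
- exact: filter_uniq (partitions_upto_uniq N).
move=> a; rewrite map_id mem_filter mem_partitions_upto.
by case: eqP => [->|]; rewrite ?n0 ?nN ?andbT ?andbF // andbC.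
Qed.

Lemma at1_Fser P N n : (n <= N)%N ->
  at1 (Fser P) n = \sum_(a <- partitions_upto N | P a) mono (weight a) 0 n.
Proof.
move=> nN; rewrite /at1 (Fser_mono P nN) horner_sum rmorph_sum.
by apply: eq_bigr => a _; rewrite /mono; case: eqP; rewrite ?hornerXn ?expr1n ?horner0.
Qed.

Lemma at1_Fser_reindex P n (I : eqType) (s : seq I) (f : I -> seq nat) :
  (0 < n)%N -> uniq s -> {in s &, injective f} ->
  (forall a, (a \in map f s) = [&& is_partition a, weight a == n & P a]) ->
  at1 (Fser P) n = (size s)%:R.
Proof.
move=> n0 us fi fs; rewrite /at1 (Fser_reindex n0 us fi fs) horner_sum rmorph_sum.
rewrite -sum1_size natr_sum; apply: eq_bigr => i _.
by rewrite hornerXn expr1n.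
Qed.

Local Close Scope ring_scope.

(** * Adding a column and raising the largest parts *)

Definition pospart a := is_partition a && (0 < weight a).

Definition rest a := drop (mult a) a.

Lemma pospartP a : pospart a ->
  [/\ a = nseq (mult a) (head 0 a) ++ rest a, 0 < mult a, 0 < head 0 a,
      all (gtn (head 0 a)) (rest a) & is_partition (rest a)].
Proof.
case/andP=> pa wa; have [M [r [ea m0 M0 rM pr]]] := topP pa wa.
have eh : head 0 a = M by rewrite ea head_top.
have er : rest a = r by rewrite /rest [X in drop _ X]ea drop_size_cat ?size_nseq.
by rewrite eh er.
Qed.

Lemma rest_top M m r : 0 < m -> all (gtn M) r -> is_partition r ->
  rest (nseq m M ++ r) = r.
Proof. by move=> m0 rM pr; rewrite /rest mult_top // drop_size_cat ?size_nseq. Qed.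

Lemma pospart_top M m r : 0 < M -> 0 < m -> all (gtn M) r -> is_partition r ->
  pospart (nseq m M ++ r).
Proof.
move=> M0 m0 rM pr; rewrite /pospart part_top // weight_top.
by rewrite addn_gt0 muln_gt0 M0 m0.
Qed.

Lemma pospart_inj a b : pospart a -> pospart b ->
  head 0 a = head 0 b -> mult a = mult b -> rest a = rest b -> a = b.
Proof.
move=> /pospartP[ea _ _ _ _] /pospartP[eb _ _ _ _] eh em er.
by rewrite ea eb eh em er.
Qed.

(** Meant for [0 < j <= mult a]: the board then gains a rightmost column of height [j]. *)
Definition addcol j a :=
  nseq j (head 0 a).+1 ++ nseq (mult a - j) (head 0 a) ++ rest a.

(** The board gains [k] columns of height [mult a] on the right. *)
Definition raise k a := nseq (mult a) (head 0 a + k) ++ rest a.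

Lemma below_top M i r : 0 < M -> all (gtn M) r -> is_partition r ->
  is_partition (nseq i M ++ r) && all (gtn M.+1) (nseq i M ++ r).
Proof.
move=> M0 rM pr; rewrite all_cat all_nseq /= ltnSn orbT /=.
have -> : all (gtn M.+1) r by apply: sub_all rM => y /=; lia.
by case: i => [|i]; rewrite andbT //; apply: part_top.
Qed.

Lemma below_topP M s : is_partition s -> all (gtn M.+1) s ->
  exists i r, [/\ s = nseq i M ++ r, all (gtn M) r & is_partition r].
Proof.
move=> ps sM; have [w0|w0] := posnP (weight s).
  exists 0, [::]; split=> //; case: (s) ps w0 => //= x s' /andP[_] /= /andP[x0 _].
  by rewrite /weight /=; lia.
have /pospartP[es m0 h0 rh pr] : pospart s by rewrite /pospart ps.
have hM : head 0 s <= M.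
  by move: sM; rewrite {1}es all_cat all_nseq eqn0Ngt m0 /= => /andP[].
have [eM|neM] := eqVneq (head 0 s) M.
  by exists (mult s), (rest s); rewrite -eM.
exists 0, s; split=> //; rewrite {1}es all_cat all_nseq /=.
apply/andP; split; first by rewrite ltn_neqAle neM hM orbT.
by apply: sub_all rh => y /=; lia.
Qed.

Section AddCol.
Variables (j : nat) (a : seq nat).
Hypotheses (pa : pospart a) (j_bd : 0 < j <= mult a).

Lemma addcol_rest : rest (addcol j a) = nseq (mult a - j) (head 0 a) ++ rest a.
Proof.
have [ea m0 h0 rh pr] := pospartP pa; have /andP[j0 jm] := j_bd.
have /andP[p1 p2] := below_top (mult a - j) h0 rh pr.
exact: rest_top.
Qed.

Lemma addcol_mult : mult (addcol j a) = j.
Proof.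
have [ea m0 h0 rh pr] := pospartP pa; have /andP[j0 jm] := j_bd.
have /andP[p1 p2] := below_top (mult a - j) h0 rh pr.
exact: mult_top.
Qed.

Lemma addcol_head : head 0 (addcol j a) = (head 0 a).+1.
Proof. by apply: head_top; case/andP: j_bd. Qed.

Lemma addcol_pospart : pospart (addcol j a).
Proof.
have [ea m0 h0 rh pr] := pospartP pa; have /andP[j0 jm] := j_bd.
have /andP[p1 p2] := below_top (mult a - j) h0 rh pr.
exact: pospart_top.
Qed.

Lemma addcol_weight : weight (addcol j a) = weight a + j.
Proof.
have [ea m0 h0 rh pr] := pospartP pa; have /andP[j0 jm] := j_bd.
by rewrite [in RHS]ea /addcol !weight_top; nia.
Qed.

End AddCol.

(** The height of the added column is the multiplicity of the new largest part, so the column can be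
    recognized and removed. *)
Lemma addcol_inj i j a b : pospart a -> pospart b ->
  0 < i <= mult a -> 0 < j <= mult b -> addcol i a = addcol j b -> a = b.
Proof.
move=> pa pb ia jb eq_ab.
have eij : i = j by rewrite -(addcol_mult pa ia) eq_ab (addcol_mult pb jb).
have eh : head 0 a = head 0 b.
  by apply: succn_inj; rewrite -(addcol_head ia) eq_ab (addcol_head jb).
have [ea ma ha rha pra] := pospartP pa; have [eb mb hb rhb prb] := pospartP pb.
have := congr1 rest eq_ab; rewrite !addcol_rest // => er.
have key : a = nseq i (head 0 a) ++ rest (addcol i a).
  by rewrite addcol_rest // catA -nseqD subnKC; [exact: ea | case/andP: ia].
have key' : b = nseq j (head 0 b) ++ rest (addcol j b).
  by rewrite addcol_rest // catA -nseqD subnKC; [exact: eb | case/andP: jb].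
by rewrite key key' eq_ab eh eij.
Qed.

(** Deleting the last column of [b] shortens its longest rows to [M], where they join the [i] rows
    that already had this length. *)
Lemma addcol_surj b : pospart b -> 1 < head 0 b ->
  exists2 a, pospart a & 0 < mult b <= mult a /\ b = addcol (mult b) a.
Proof.
move=> pb h1; have [eb m0 _ rh pr] := pospartP pb.
case hb: (head 0 b) h1 rh => [//|M] M0 rh.
have [i [r [er rM pr']]] := below_topP pr rh.
have im : 0 < mult b + i by rewrite addn_gt0 m0.
exists (nseq (mult b + i) M ++ r); first by apply: pospart_top.
rewrite /addcol mult_top // rest_top // head_top // m0 leq_addr; split=> //.
by rewrite {1}eb hb er addKn.
Qed.

Section Raise.
Variables (k : nat) (a : seq nat).
Hypothesis pa : pospart a.

Let rh' : all (gtn (head 0 a + k)) (rest a).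
Proof. by have [_ _ _ rh _] := pospartP pa; apply: sub_all rh => y /=; lia. Qed.

Lemma raise_rest : rest (raise k a) = rest a.
Proof. by have [_ m0 _ _ pr] := pospartP pa; apply: rest_top. Qed.

Lemma raise_mult : mult (raise k a) = mult a.
Proof. by have [_ m0 _ _ pr] := pospartP pa; apply: mult_top. Qed.

Lemma raise_head : head 0 (raise k a) = head 0 a + k.
Proof. by have [_ m0 _ _ pr] := pospartP pa; apply: head_top. Qed.

Lemma raise_pospart : pospart (raise k a).
Proof.
by have [_ m0 h0 _ pr] := pospartP pa; apply: pospart_top => //; rewrite addn_gt0 h0.
Qed.

Lemma raise_weight : weight (raise k a) = weight a + mult a * k.
Proof.
by have [ea _ _ _ _] := pospartP pa; rewrite {2}ea /raise !weight_top; nia.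
Qed.

End Raise.

(** * Effect of the two moves on containment *)

Section Pattern.
Variables (x : nat) (q : seq nat).
Hypothesis sxq : strict (x :: q).

Let d := x - head 0 q.
Let d_gt0 : 0 < d.
Proof. by move: sxq; rewrite strict_cons /d => /andP[]; lia. Qed.

(** A part [v] on top of the parts [r] can play the role of [x]. With h the largest part of [a] and
    r the rest, [a] contains [x :: q] when h fits, [x.+1 :: q] when h - 1 fits, and
    [[:: x.+1, x & q]] when some part in r fits. Monotonicity in [v] then drives all comparisons. *)
Let fits r v := (d <= v) && reach r q (v - d).

Let fits_leq r v w : v <= w -> fits r v -> fits r w.
Proof.
move=> vw /andP[dv rv]; rewrite /fits (leq_trans dv) //=.
by apply: reach_leq rv; lia.
Qed.

(** The parts matched with [q] are at most [v - d], hence below [M]. *)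
Let fits_cat M i r v : v <= M -> fits (nseq i M ++ r) v = fits r v.
Proof.
move=> vM; rewrite /fits; case: (leqP d v) => //= dv.
apply: eq_reach => y yv; rewrite mem_cat mem_nseq (_ : (y == M) = false) ?andbF //.
by apply/negbTE; rewrite neq_ltn; apply/orP; left; lia.
Qed.

Let strict1 : strict (x.+1 :: q).
Proof. exact: strict_succ. Qed.

Let strict3 : strict [:: x.+1, x & q].
Proof. by rewrite strict_cons sxq ltnSn. Qed.

Lemma contains_cons a : pospart a ->
  contains a (x :: q) = fits (rest a) (head 0 a).
Proof. by case/pospartP=> ea m0 h0 rh pr; rewrite {1}ea contains_top. Qed.

Let contains_succ a : pospart a ->
  contains a (x.+1 :: q) = fits (rest a) (head 0 a).-1.
Proof.
case/pospartP=> ea m0 h0 rh pr; rewrite {1}ea contains_top //.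
have [hq _] := andP (etrans (esym (strict_cons _ _)) sxq).
rewrite /fits subSn ?(ltnW hq) // -/d.
have -> : (d < head 0 a) = (d <= (head 0 a).-1) by lia.
by rewrite (_ : head 0 a - d.+1 = (head 0 a).-1 - d) //; lia.
Qed.

Let contains_dup a : pospart a ->
  contains a [:: x.+1, x & q] = has (fits (rest a)) (rest a).
Proof.
case/pospartP=> ea m0 h0 rh pr; rewrite {1}ea contains_top //= subSnn h0 /=.
apply: eq_in_has => y yr; have /= yh := allP rh y yr.
by rewrite (_ : y <= head 0 a - 1) //; lia.
Qed.

Lemma contains_succW a : pospart a -> contains a (x.+1 :: q) -> contains a (x :: q).
Proof.
by move=> pa; rewrite contains_succ // contains_cons //; apply: fits_leq; apply: leq_pred.
Qed.

Lemma contains_dupW a : pospart a -> contains a [:: x.+1, x & q] -> contains a (x :: q).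
Proof.
move=> pa; rewrite contains_dup // contains_cons // => /hasP[y yr].
have [_ _ _ rh _] := pospartP pa; have /= yh := allP rh y yr.
by apply: fits_leq; apply: ltnW.
Qed.

(** The new largest part minus 1 is the old one, and by [fits_cat] the copies of the old one left in
    the rest change nothing. *)
Lemma contains_addcol j a : pospart a -> 0 < j <= mult a ->
  contains (addcol j a) (x.+1 :: q) = contains a (x :: q).
Proof.
move=> pa ja; rewrite contains_succ ?addcol_pospart // contains_cons //.
by rewrite addcol_rest // addcol_head // fits_cat.
Qed.

(** If [j < mult a], a copy of the old largest part stays in the rest and is the best candidate for
    [x]; if [j = mult a], the rest is that of [a]. *)
Lemma contains_addcol_dup j a : pospart a -> 0 < j <= mult a ->
  contains (addcol j a) [:: x.+1, x & q] =
  contains a (if j < mult a then x :: q else [:: x.+1, x & q]).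
Proof.
move=> pa /andP[j0 jm]; have ja : 0 < j <= mult a by rewrite j0.
rewrite contains_dup ?addcol_pospart // addcol_rest //.
have [_ _ _ rh _] := pospartP pa.
have [jlt|jge] := ltnP j (mult a); last first.
  by rewrite contains_dup // (_ : mult a - j = 0) //; lia.
rewrite contains_cons // has_cat has_nseq subn_gt0 jlt /= fits_cat //.
apply/orb_idr => /hasP[y yr]; have /= yh := allP rh y yr.
by rewrite fits_cat 1?ltnW //; apply: fits_leq; apply: ltnW.
Qed.

(** The hypotheses make the largest part of [a] the least value that fits its rest. Raising it keeps
    it fitting, and the parts in the rest are too small to fit. *)
Lemma raise_contains k a : pospart a -> contains a (x :: q) -> ~~ contains a (x.+1 :: q) ->
  contains (raise k a) (x :: q) && ~~ contains (raise k a) [:: x.+1, x & q].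
Proof.
move=> pa; rewrite contains_cons // contains_succ // => fa nfa.
rewrite contains_cons ?contains_dup ?raise_pospart // raise_rest // raise_head //.
rewrite (fits_leq _ fa) ?leq_addr //=; apply: contra nfa => /hasP[y yr].
have [_ _ _ rh _] := pospartP pa; have /= yh := allP rh y yr.
by apply: fits_leq; rewrite -ltnS prednK //; apply: leq_ltn_trans yh.
Qed.

(** Raising preserves the rest, and the rest determines the original largest part as the least value
    that fits. *)
Lemma raise_inj k l a b : pospart a -> pospart b ->
  contains a (x :: q) -> ~~ contains a (x.+1 :: q) ->
  contains b (x :: q) -> ~~ contains b (x.+1 :: q) ->
  raise k a = raise l b -> a = b.
Proof.
move=> pa pb; rewrite !contains_cons // !contains_succ // => fa nfa fb nfb eq_ab.
have er : rest a = rest b by rewrite -(raise_rest k pa) eq_ab raise_rest.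
have em : mult a = mult b by rewrite -(raise_mult k pa) eq_ab raise_mult.
apply: pospart_inj => //; rewrite er in fa nfa.
case: (ltngtP (head 0 a) (head 0 b)) => // h.
  by case/negP: nfb; apply: fits_leq fa; rewrite -ltnS (ltn_predK h).
by case/negP: nfa; apply: fits_leq fb; rewrite -ltnS (ltn_predK h).
Qed.

(** The largest part is lowered to the least [M] that fits the rest. No part in the rest fits, so
    all of them lie below [M]. *)
Lemma raise_surj b : pospart b -> contains b (x :: q) -> ~~ contains b [:: x.+1, x & q] ->
  exists2 a, pospart a &
    [/\ contains a (x :: q), ~~ contains a (x.+1 :: q) & exists k, b = raise k a].
Proof.
move=> pb; rewrite contains_cons // contains_dup // => fb /hasPn nfb.
have [eb m0 h0 rh pr] := pospartP pb.
have exM : exists v, fits (rest b) v by exists (head 0 b).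
have [M fM minM] := ex_minnP exM.
have Mb : M <= head 0 b := minM _ fb.
have M0 : 0 < M by have /andP[dM _] := fM; apply: leq_trans dM.
have rM : all (gtn M) (rest b).
  apply/allP => y yr /=; rewrite ltnNge; apply: contra (nfb y yr) => My.
  exact: fits_leq My fM.
have pa := pospart_top M0 m0 rM pr.
exists (nseq (mult b) M ++ rest b) => //.
rewrite contains_cons // contains_succ // rest_top // head_top // fM; split=> //.
  by apply/negP => /minM; rewrite leqNgt prednK ?leqnn.
exists (head 0 b - M).
by rewrite /raise mult_top // rest_top // head_top // subnKC.
Qed.

End Pattern.

Local Open Scope ring_scope.

(** * The two steps *)

Definition succ_head (p : seq nat) := (head 0 p).+1 :: behead p.

Definition theta_id (p : seq nat) (G : series) := forall n,
  G n = at1 (Fser (fun a => avoids a p)) n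
        + Fser (fun a => contains a p && avoids a (succ_head p)) n.

Lemma pospart_upto N a : a \in partitions_upto N -> pospart a.
Proof. by rewrite mem_partitions_upto => /andP[pa /andP[wa _]]; rewrite /pospart pa. Qed.

Lemma theta_id0 p G : theta_id p G -> G 0%N = 0.
Proof. by move=> ->; rewrite /at1 /Fser /= horner0 addr0. Qed.

Lemma opE0 G : G 0%N = 0 -> opE G 0 = 0.
Proof. by move=> G0; rewrite /opE big_ord1 /= G0 horner0 subrr mul0r. Qed.

Lemma opN0 G : G 0%N = 0 -> opN G 0 = 0.
Proof.
move=> G0; rewrite /opN G0 horner0 add0r big_pred0 // => i.
by rewrite ord1.
Qed.

(** Avoiding [x :: q] implies avoiding [x.+1 :: q], so both terms merge into one sum over the
    partitions avoiding the latter; those avoiding [x :: q] carry t^0. *)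
Lemma theta_id_sum x q G N n : strict (x :: q) -> theta_id (x :: q) G -> (n <= N)%N ->
  G n = \sum_(a <- [seq a <- partitions_upto N | avoids a (x.+1 :: q)])
          mono (weight a) (if contains a (x :: q) then mult a else 0) n.
Proof.
move=> sp -> nN; rewrite (at1_Fser _ nN) (Fser_mono _ nN) big_filter.
rewrite [RHS](bigID (fun a => avoids a (x :: q))) /=; congr (_ + _).
  rewrite [LHS]big_seq_cond [RHS]big_seq_cond; apply: eq_big => a.
    case aN: (a \in partitions_upto N) => //=; rewrite andbC; apply/esym/andb_idr.
    by apply: contra; apply: contains_succW => //; apply: pospart_upto aN.
  by case/andP=> _; rewrite /avoids => /negbTE->.
apply: eq_big => a; first by rewrite /avoids negbK andbC.
by case/andP=> ->.
Qed.

(** Every partition of positive weight contains (1), and the only one of weight n avoiding (2) has n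
    parts equal to 1. *)
Lemma theta_id_zt : theta_id [:: 1%N] zt_series.
Proof.
move=> n; have [->|n0] := posnP n; first by rewrite /at1 /Fser /= horner0 addr0.
have ct a : pospart a -> contains a [:: 1%N] && (contains a [:: 2] == (1 < head 0 a))%N.
  move=> pa; have [ea m0 h0 rh pr] := pospartP pa.
  by rewrite ea !contains_top //= -ea !andbT h0 eqxx.
rewrite (@at1_Fser_reindex _ n _ [::] id) //; last first.
  move=> a; apply/esym/negP => /and3P[pa /eqP wa].
  have /ct/andP[ca _] : pospart a by rewrite /pospart pa wa.
  by rewrite /avoids ca.
rewrite (@Fser_reindex _ n _ [:: nseq n 1%N] id) //; last first.
  move=> a; rewrite inE; apply/eqP/and3P => [->|[pa /eqP wa]].
    have pa : pospart (nseq n 1%N).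
      by rewrite -[nseq n 1%N]cats0; apply: pospart_top.
    split; first by case/andP: pa.
      by rewrite /weight sumn_nseq mul1n.
    by have /andP[-> /eqP] := ct _ pa; rewrite /avoids => ->; case: (n).
  have pa' : pospart a by rewrite /pospart pa wa.
  have [ea m0 h0 rh pr] := pospartP pa'.
  have /andP[-> /eqP] := ct _ pa'; rewrite /avoids => -> /=; rewrite -leqNgt => h1.
  have h1' : head 0%N a = 1%N by apply/eqP; rewrite eqn_leq h1 h0.
  have r0 : rest a = [::].
    case: (rest a) rh pr => //= y r; rewrite h1' => /andP[y1 _] /andP[_ /andP[y0 _]]; lia.
  by move: ea wa; rewrite r0 h1' cats0 => -> ; rewrite /weight sumn_nseq mul1n => ->.
rewrite big_seq1 /= add0r /zt_series (gtn_eqF n0) -[nseq n 1%N]cats0.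
by rewrite mult_top.
Qed.

(** Each [a] avoiding [x.+1 :: q] gives 1 at degree [weight a], which makes up the part at t = 1. If
    it contains [x :: q], it also gives t^j at degree [weight a + j] for 1 <= j <= [mult a], the
    term of [addcol j a]. *)
Lemma theta_id_opE x q G : strict (x :: q) -> theta_id (x :: q) G ->
  theta_id (x.+1 :: q) (opE G).
Proof.
move=> sp cG N; have [->|N0] := posnP N.
  by rewrite (opE0 (theta_id0 cG)) /at1 /Fser /= horner0 addr0.
rewrite (opE_ext (fun n nN => theta_id_sum sp cG nN)) opE_sum.
pose P a := (contains a (x :: q) && (weight a < N <= weight a + mult a)%N).
have sx := strict_succ sp.
pose s := [seq a <- [seq a <- partitions_upto N | avoids a (x.+1 :: q)] | P a].
have sP a : a \in s -> [/\ pospart a, contains a (x :: q), avoids a (x.+1 :: q),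
    (0 < N - weight a <= mult a)%N & (weight a < N)%N].
  rewrite 2!mem_filter => /andP[/andP[ca wN] /andP[av aN]].
  by split=> //; [apply: pospart_upto aN | lia | lia].
rewrite (@at1_Fser _ N) // -[X in _ = X + _]big_filter.
rewrite (@Fser_reindex _ N _ s (fun a => addcol (N - weight a) a)) //; first last.
- move=> b; apply/mapP/and3P => [[a /sP[pa ca av jb wN] ->]|[pb /eqP wb /andP[cb nb]]].
    have /andP[-> _] := addcol_pospart pa jb.
    rewrite addcol_weight // subnKC ?eqxx 1?ltnW // contains_addcol //.
    rewrite /avoids contains_addcol ?ca //.
  have pb' : pospart b by rewrite /pospart pb wb.
  have [eb m0 h0 rh pr] := pospartP pb'.
  (* The gap [x.+1 - head 0 q] is at least 2. *)
  have h1 : (1 < head 0 b)%N.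
    move: cb; rewrite eb contains_top // -eb => /andP[h _].
    by move: sp; rewrite strict_cons => /andP[]; lia.
  have [a pa [mm eba]] := addcol_surj pb' h1.
  have mb : (0 < mult b <= mult a)%N by [].
  have wab : weight b = (weight a + mult b)%N by rewrite eba addcol_weight // -eba.
  have jb : (N - weight a)%N = mult b by lia.
  exists a; last by rewrite jb.
  have ca : contains a (x :: q) by move: cb; rewrite eba contains_addcol // -eba.
  have av : avoids a (x.+1 :: q).
    by move: nb; rewrite /avoids /succ_head /= eba contains_addcol // -eba.
  rewrite 2!mem_filter /P ca av mem_partitions_upto /=; case/andP: (pa) => -> -> /=.
  by move: wab wb mb; clear; lia.
- move=> a b /sP[pa _ _ ja _] /sP[pb _ _ jb _]; exact: addcol_inj.
- exact: filter_uniq (filter_uniq _ (partitions_upto_uniq N)).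
have -> : \sum_(a <- s) 'X^(mult (addcol (N - weight a) a)) =
    \sum_(a <- s) 'X^(N - weight a) :> {poly int}.
  by apply: eq_big_seq => a /sP[pa _ _ ja _]; rewrite addcol_mult.
rewrite /s [X in _ = _ + X]big_filter [X in _ = _ + X]big_mkcond -big_split /=.
apply: eq_big_seq => a; rewrite mem_filter => /andP[_ aN].
have [_ m0 _ _ _] := pospartP (pospart_upto aN).
rewrite opE_mono /mono /P expr0.
case: (contains _ _); case: (ltngtP (weight a) N) => [wN|wN|->] /=;
  rewrite ?addn0 ?subnn ?addr0 ?add0r ?leq_addr //.
  by rewrite leqNgt wN.
by rewrite leqnn.
Qed.

(** Division of [N - weight a] by [mult a] gives the raise [k a] and the column height [j a].
    Remainder 0 yields the partitions containing [x :: q] and avoiding the new pattern [pi]; the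
    others yield those containing [pi] and avoiding [rho]. *)
Lemma theta_id_opN x q G : strict (x :: q) -> theta_id (x :: q) G ->
  theta_id [:: x.+1, x & q] (opN G).
Proof.
move=> sp cG N; have [->|N0] := posnP N.
  by rewrite (opN0 (theta_id0 cG)) /at1 /Fser /= horner0 addr0.
rewrite (opN_ext (fun n nN => theta_id_sum sp cG nN)) opN_sum.
set L := [seq a <- partitions_upto N | avoids a (x.+1 :: q)].
pose j a := ((N - weight a) %% mult a)%N.
pose k a := ((N - weight a) %/ mult a)%N.
pose s := [seq a <- L | contains a (x :: q)].
have sP a : a \in s -> [/\ pospart a, contains a (x :: q), avoids a (x.+1 :: q),
    (weight a + mult a * k a + j a)%N = N & (j a < mult a)%N].
  rewrite 2!mem_filter => /andP[ca /andP[av aN]]; have pa := pospart_upto aN.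
  have [_ m0 _ _ _] := pospartP pa.
  move: aN; rewrite mem_partitions_upto => /andP[_ /andP[_ wN]].
  by split=> //; [rewrite /k /j; have := divn_eq (N - weight a) (mult a); lia | rewrite ltn_mod].
(* Since [i < mult b], division forces the raise found by [raise_surj] to be [k a] and the remainder
   to be [i]. *)
have sI b i : pospart b -> contains b (x :: q) -> ~~ contains b [:: x.+1, x & q] ->
    weight b = (N - i)%N -> (i < mult b)%N -> (i < N)%N ->
    exists2 a, a \in s & b = raise (k a) a /\ j a = i.
  move=> pb cb nb wb ib iN; have [a' pa [ca av [l eb]]] := raise_surj sp pb cb nb.
  have [_ m0 _ _ _] := pospartP pa.
  move: ib wb; rewrite eb raise_weight // raise_mult // => ib wb.
  have Nw : (N - weight a' = l * mult a' + i)%N by lia.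
  exists a'.
    by rewrite 2!mem_filter ca /avoids av mem_partitions_upto; case/andP: (pa) => -> -> /=; lia.
  by rewrite /k /j Nw divnMDl // divn_small // addn0 modnMDl modn_small.
pose tp := x :: q; pose pi := [:: x.+1, x & q]; pose rho := [:: x.+2, x & q].
have s3 : strict pi by rewrite /pi strict_cons /= ltnSn.
have su (P : pred (seq nat)) : uniq [seq a <- s | P a].
  by do 3!apply: filter_uniq; apply: partitions_upto_uniq.
have E1 : at1 (Fser (fun a => contains a tp && avoids a pi)) N =
    (size [seq a <- s | j a == 0%N])%:R.
  apply: (@at1_Fser_reindex _ N _ _ (fun a => raise (k a) a)) => //.
    move=> a b; rewrite mem_filter => /andP[_ /sP[pa ca av _ _]].
    rewrite mem_filter => /andP[_ /sP[pb cb bv _ _]].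
    exact: (@raise_inj x q).
  move=> b; apply/mapP/and3P => [[a]|[pb /eqP wb /andP[cb nb]]].
    rewrite mem_filter => /andP[/eqP j0 /sP[pa ca av wN jm]] ->.
    have /andP[-> _] := raise_pospart (k a) pa.
    rewrite raise_weight // -[X in _ == X]wN j0 addn0 eqxx; split=> //.
    exact: raise_contains.
  have pb' : pospart b by rewrite /pospart pb wb.
  have [_ m0 _ _ _] := pospartP pb'.
  have wb0 : weight b = (N - 0)%N by rewrite subn0.
  have [a as_ [eb ja]] := sI b 0%N pb' cb nb wb0 m0 N0.
  by exists a; rewrite // mem_filter ja as_.
have E2 : Fser (fun a => contains a pi && avoids a rho) N =
    \sum_(a <- s | j a != 0%N) 'X^(j a).
  rewrite -big_filter.
  rewrite (@Fser_reindex _ N _ [seq a <- s | j a != 0%N]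
     (fun a => addcol (j a) (raise (k a) a))) //.
  - apply: eq_big_seq => a; rewrite mem_filter => /andP[j0 /sP[pa ca av wN jm]].
    by rewrite addcol_mult ?raise_pospart // raise_mult // lt0n j0 ltnW.
  - move=> a b; rewrite mem_filter => /andP[ja /sP[pa ca av _ jma]].
    rewrite mem_filter => /andP[jb /sP[pb cb bv _ jmb]].
    have bd c : j c != 0%N -> pospart c -> (j c < mult c)%N ->
        (0 < j c <= mult (raise (k c) c))%N.
      by move=> jc pc jmc; rewrite raise_mult // lt0n jc ltnW.
    move/(addcol_inj (raise_pospart _ pa) (raise_pospart _ pb) (bd _ ja pa jma) (bd _ jb pb jmb)).
    exact: (@raise_inj x q).
  move=> b; apply/mapP/and3P => [[a]|[pb /eqP wb /andP[cb nb]]].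
    rewrite mem_filter => /andP[j0 /sP[pa ca av wN jm]] ->.
    have pr := raise_pospart (k a) pa.
    have jb : (0 < j a <= mult (raise (k a) a))%N by rewrite raise_mult // lt0n j0 ltnW.
    have /andP[-> _] := addcol_pospart pr jb.
    rewrite addcol_weight // raise_weight // wN eqxx; split=> //.
    rewrite contains_addcol_dup // raise_mult // jm /avoids contains_addcol //.
    exact: raise_contains.
  have pb' : pospart b by rewrite /pospart pb wb.
  have [eb m0 h0 rh pr] := pospartP pb'.
  have h1 : (1 < head 0 b)%N.
    move: cb; rewrite eb contains_top // -eb /= => /andP[_ /hasP[y yr /and3P[yh y0 _]]].
    by move: sp; rewrite strict_cons => /andP[]; lia.
  have [a pa [mm eba]] := addcol_surj pb' h1.
  have mb : (0 < mult b <= mult a)%N by [].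
  have na : ~~ contains a pi by move: nb; rewrite /avoids eba /rho contains_addcol // -eba.
  move: cb; rewrite eba contains_addcol_dup // -eba.
  (* A column of full height would make [b] avoid [pi] along with [a]. *)
  have [mlt ca|_] := ltnP (mult b) (mult a); last by rewrite (negbTE na).
  have wab : weight b = (weight a + mult b)%N by rewrite eba addcol_weight // -eba.
  have wa : weight a = (N - mult b)%N by rewrite -wb wab addnK.
  have mN : (mult b < N)%N by case/andP: pa => _ wa0; rewrite -wb wab; lia.
  have [a' as_ [ea ja]] := sI a (mult b) pa ca na wa mlt mN.
  exists a'; first by rewrite mem_filter ja as_ -lt0n m0.
  by rewrite ja -ea.
have E3 : at1 (Fser (fun a => avoids a pi)) N =
    at1 (Fser (fun a => avoids a tp)) N +
    at1 (Fser (fun a => contains a tp && avoids a pi)) N.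
  rewrite !(@at1_Fser _ N) // (bigID (fun a => avoids a tp)) /=; congr (_ + _).
    rewrite [LHS]big_seq_cond [RHS]big_seq_cond; apply: eq_bigl => a.
    case aN: (a \in partitions_upto N) => //=; apply/andb_idl.
    by apply: contra; apply: contains_dupW => //; apply: pospart_upto aN.
  by apply: eq_bigl => a; rewrite /avoids negbK andbC.
(* For remainder 0 the power of t is 1, so the count and the sum combine. *)
have E4 : (size [seq a <- s | j a == 0%N])%:R + \sum_(a <- s | j a != 0%N) 'X^(j a) =
    \sum_(a <- L | contains a (x :: q)) 'X^(j a) :> {poly int}.
  rewrite -[RHS]big_filter [RHS](bigID (fun a => j a == 0%N)) /= -sum1_size natr_sum.
  by rewrite big_filter; congr (_ + _); apply: eq_bigr => a /eqP->.
rewrite -/pi E3 E1 [Fser _ N]E2 -addrA E4.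
rewrite (bigID (fun a => contains a (x :: q))) /= addrC (@at1_Fser _ N) //.
congr (_ + _).
  rewrite /L big_filter_cond [LHS]big_seq_cond [RHS]big_seq_cond; apply: eq_big => a.
    case aN: (a \in partitions_upto N) => //=; apply/andb_idl.
    by apply: contra; apply: contains_succW => //; apply: pospart_upto aN.
  by case/and3P=> _ _ /negbTE->; rewrite opN_mono0.
rewrite [LHS]big_seq_cond [RHS]big_seq_cond; apply: eq_bigr => a.
rewrite mem_filter => /andP[/andP[_ aN] ->].
have pa := pospart_upto aN; have [_ m0 _ _ _] := pospartP pa.
by move: aN; rewrite mem_partitions_upto => /and3P[_ w0 wN]; rewrite opN_mono // wN.
Qed.

(** * Reading the border *)

(** The partition is rebuilt from the bottom of its border: an east step widens the current top row,
    a north-east step puts a row longer by 1 above it. *)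
Definition step_sym (p : seq nat) (o : sym) : seq nat :=
  if o is SymE then succ_head p else (head 0%N p).+1 :: p.

Definition steps_of (o : sym) : seq bool :=
  if o is SymE then [:: true] else [:: false; true].

Definition path_of (Th : seq sym) : seq bool := flatten (map steps_of Th).

Lemma tok_path_of Th : tok (path_of Th) = Th.
Proof. by elim: Th => [|[] Th IH] //=; rewrite -[in RHS]IH. Qed.

Lemma strict_step p o : strict p -> p != [::] -> strict (step_sym p o).
Proof.
case: p => //= x q sp _; case: o; last by rewrite strict_cons sp /= ltnSn.
exact: strict_succ.
Qed.

Lemma theta_id_step p o G : strict p -> p != [::] -> theta_id p G ->
  theta_id (step_sym p o) (apply_sym o G).
Proof.
by case: p => //= x q sp _; case: o; [apply: theta_id_opE | apply: theta_id_opN].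
Qed.

Lemma theta_id_steps Th p G : strict p -> p != [::] -> theta_id p G ->
  theta_id (foldl step_sym p Th) (foldl (fun H o => apply_sym o H) G Th).
Proof.
elim: Th p G => //= o Th IH p G sp p0 cG; apply: IH.
- exact: strict_step.
- by case: (o).
exact: theta_id_step.
Qed.

Lemma border_cons y p :
  border (y :: p) = border p ++ rcons (nseq (y - head 0%N p) true) false.
Proof.
rewrite /border rev_cons.
have -> : pairmap (fun u v => (v - u)%N) 0%N (rcons (rev p) y) =
    rcons (pairmap (fun u v => (v - u)%N) 0%N (rev p)) (y - head 0%N p)%N.
  rewrite -cats1 pairmap_cat /= cats1; congr (rcons _ (_ - _)%N).
  by case: p => //= x p; rewrite rev_cons last_rcons.
by rewrite map_rcons flatten_rcons.
Qed.

(** By strictness each row exceeds the one below, so every inner north step is followed by an east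
    step. The start (1) accounts for the initial east and the final north step. *)
Lemma border_path y p : strict (y :: p) -> exists Th,
  border (y :: p) = true :: rcons (path_of Th) false /\
  foldl step_sym [:: 1%N] Th = y :: p.
Proof.
have path_nseq n : path_of (nseq n SymE) = nseq n true by elim: n => //= n <-.
have foldE n x q : foldl step_sym (x :: q) (nseq n SymE) = (x + n)%N :: q.
  by elim: n x => [|n IH] x /=; rewrite ?addn0 // IH addSnnS.
elim: p y => [|x p IH] y.
  case: y => [|y] // _; exists (nseq y SymE).
  by rewrite foldE border_cons path_nseq.
rewrite strict_cons => /andP[/= xy /IH[Th [bTh fTh]]].
exists (Th ++ SymN :: nseq (y - x).-1 SymE); split; last first.
  by rewrite foldl_cat fTh /= foldE; congr (_ :: _); lia.
rewrite border_cons bTh /= -[in LHS](@prednK (y - x)) ?subn_gt0 //.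
have -> : path_of (Th ++ SymN :: nseq (y - x).-1 SymE) =
    path_of Th ++ [:: false, true & nseq (y - x).-1 true].
  by rewrite -path_nseq /path_of map_cat flatten_cat.
by rewrite /= cat_rcons rcons_cat.
Qed.

(** The border of [x.+1 :: p] is that of [x :: p] with an east step inserted before the last north
    step. Hence the symbols read for mu are those that build tau from (1). *)
Lemma Theta_seq_border x p Th : (head 0%N p < x)%N ->
  border (x :: p) = true :: rcons (path_of Th) false ->
  Theta_seq (x.+1 :: p) = Th.
Proof.
rewrite border_cons -rcons_cat -rcons_cons => px /rcons_inj[e].
have eb : border (x.+1 :: p) = true :: path_of Th ++ [:: true; false].
  by rewrite border_cons subSn 1?ltnW // -addn1 nseqD -cats1 -!catA catA e.
(* The 3 counts the initial east step and the final east and north steps. *)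
rewrite /Theta_seq eb /= size_cat /= (_ : _ - 3 = size (path_of Th))%N; last by lia.
by rewrite take_size_cat // tok_path_of.
Qed.

(** Partitions avoiding [x.+1 :: q] are split by whether they contain [x :: q]. This gives the
    specialization at t = 1. *)
Lemma avoids_succ_split x q n : strict (x :: q) ->
  at1 (Fser (fun a => avoids a (x.+1 :: q))) n =
  at1 (fun n => at1 (Fser (fun a => avoids a (x :: q))) n +
    Fser (fun a => contains a (x :: q) && avoids a (x.+1 :: q)) n) n.
Proof.
move=> sp; have at1D F G : at1 (fun n => at1 F n + G n) n = at1 F n + at1 G n.
  by rewrite /at1 hornerD hornerC rmorphD.
rewrite at1D !(@at1_Fser _ n) // (bigID (fun a => avoids a (x :: q))) /=; congr (_ + _).
  rewrite [LHS]big_seq_cond [RHS]big_seq_cond; apply: eq_bigl => a.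
  case aN: (a \in partitions_upto n) => //=; apply/andb_idl.
  by apply: contra; apply: contains_succW => //; apply: pospart_upto aN.
by apply: eq_bigl => a; rewrite /avoids negbK andbC.
Qed.

Theorem mainTheorem1 (mu : seq nat) :
  superstrict mu -> (2 <= weight mu)%N ->
  let tau := ((head 0 mu).-1 :: behead mu)%N in
  (forall n : nat,
     Theta mu zt_series n =
       at1 (Fser (fun a => avoids a tau)) n
       + Fser (fun a => contains a tau && avoids a mu) n)
  /\
  (forall n : nat,
     at1 (Fser (fun a => avoids a mu)) n = at1 (Theta mu zt_series) n).
Proof.
case: mu => [|[|x] p] // ss wm tau; first by case/andP: ss.
(* A gap of at least 2 under the first part of mu leaves tau strict; if [p] is empty, the weight
   bound makes [x] positive. *)
have st : strict (x :: p).
  case/andP: ss => s1 /= ps; rewrite strict_cons /strict ps andbT.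
  rewrite (_ : sorted gtn p); last first.
    by apply: sub_sorted (path_sorted s1) => u v /=; lia.
  rewrite andbT; case: p s1 wm {tau ps} => [|y p]; rewrite /weight /=; lia.
have [Th [bTh fTh]] := border_path st.
have px : (head 0%N p < x)%N by move: st; rewrite strict_cons => /andP[].
have cT : theta_id tau (Theta (x.+1 :: p) zt_series).
  rewrite /Theta (Theta_seq_border px bTh) /tau /= -fTh.
  by apply: theta_id_steps => //; apply: theta_id_zt.
split=> [//|n]; rewrite (avoids_succ_split n st) /at1.
by congr (_.[1])%:P; rewrite cT.
Qed.
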